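(* Let $\mu>0$ and let the wallclock times taken by each of $P$ workers to process a single mini-batch be i.i.d. (across workers and mini-batches) exponential random variables with rate $\mu$. Then the ratio of the expected runtimes per iteration for synchronous and asynchronous SGD satisfies $$\frac{\mathbb{E}[T_{Sync}]}{\mathbb{E}[T_{Async}]}=\Theta(P\log P)\qquad (P\to\infty).$$
   Context: A central parameter server (PS) interacts with $P$ parallel workers. Each worker repeatedly computes the gradient on one mini-batch; computation times are i.i.d. across workers and mini-batches. Everything other than computation takes zero time. An iteration is one update of the parameter at the PS; the expected runtime per iteration is the expected time between two consecutive updates. Synchronous SGD: at each iteration all $P$ workers start a fresh mini-batch simultaneously, and the PS updates when all $P$ of them have finished; then all workers start afresh. $T_{Sync}$ is the duration of one iteration. Asynchronous SGD: each worker, independently of the others, starts a new mini-batch as soon as it finishes (pushes) the previous one, and every push by any worker triggers one update at the PS. The expected runtime per iteration is understood in the limit of a large number of iterations: $\mathbb{E}[T_{Async}]=\lim_{J\to\infty}\mathbb{E}[S_J]/J$, where $S_J$ is the time of the $J$-th update (all workers starting at time $0$). *)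

(* Defs.v *)
From HB Require Import structures.
From mathcomp Require Import all_boot all_order all_algebra.
From mathcomp Require Import finmap.
From mathcomp Require Import all_classical all_reals all_analysis.

Set Implicit Arguments.
Unset Strict Implicit.
Unset Printing Implicit Defensive.

Import Order.TTheory GRing.Theory Num.Theory.
Import numFieldNormedType.Exports.

Local Open Scope classical_set_scope.
Local Open Scope card_scope.
Local Open Scope ring_scope.

Section independence.
Context {d : measure_display} {T : measurableType d} {R : realType}.
Context (Pr : probability T R).

Definition mutually_independent {I : choiceType} (X : I -> {RV Pr >-> R}) :=
  forall (J : {fset I}) (B : I -> set R),
    (forall a, measurable (B a)) ->
    (Pr (\bigcap_(a in [set` J]) (X a @^-1` B a)) =
     \prod_(a <- J) Pr (X a @^-1` B a))%E.

(* The equation is only required on measurable sets: both sides are total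
   functions on [set R], with no meaning outside the Borel sets. *)
Definition exponentially_distributed (mu : R) (X : {RV Pr >-> R}) :=
  forall A : set R, measurable A -> distribution Pr X A = exponential_prob mu A.

End independence.

(* [X i k] is the time worker [i] takes to process its [k]-th mini-batch
   ([k] is counted from 0), for [n] workers. *)
Section runtimes.
Context {d : measure_display} {T : measurableType d} {R : realType}.
Context (Pr : probability T R) {n : nat} (X : 'I_n -> nat -> {RV Pr >-> R}).

Definition iid_exponential (mu : R) :=
  mutually_independent (fun a : 'I_n * nat => X a.1 a.2) /\
  (forall i k, exponentially_distributed mu (X i k)).

(* The default value 0 of the maximum is harmless for [0 < n], computation
   times being almost surely nonnegative. *)
Definition sync_runtime (j : nat) (w : T) : R :=
  \big[Order.max/0]_(i < n) X i j w.

Definition expected_sync_runtime (j : nat) : \bar R :=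
  ('E_Pr[sync_runtime j])%E.

Definition push_time (i : 'I_n) (k : nat) (w : T) : R :=
  \sum_(l < k.+1) X i l w.

(* Time of the [J]-th update: the first time by which at least [J] pushes,
   all workers together and counted with multiplicity, have occurred. *)
Definition async_update_time (J : nat) (w : T) : R :=
  inf [set t | `I_J #<= [set a : 'I_n * nat | push_time a.1 a.2 w <= t]].

Definition mean_async_runtime (J : nat) : \bar R :=
  ('E_Pr[async_update_time J] / J%:R%:E)%E.

Definition expected_async_runtime : \bar R := limn mean_async_runtime.

End runtimes.

(* Main.v *)
(** A synchronous iteration lasts for the maximum of [n] independent
    exponential times.  Its expectation is at most a constant times [ln n + 2],
    because the exponential moment at [mu / 2] is [2], and at least
    [ln n / (2 * mu)], because the maximum exceeds [ln n / mu] with probability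
    [1 - (1 - 1 / n) ^ n >= 1 / 2].

    For the asynchronous scheme, let [n * k < J <= n * (k + 1)].  The [J]-th
    update cannot occur before some worker has completed [k + 1] mini-batches,
    and has occurred once every worker has.  It is therefore within
    [\sum_i |S_i - (k + 1) / mu|] of [(k + 1) / mu], where [S_i] is the time
    worker [i] takes for [k + 1] mini-batches.  By independence the variance of
    [S_i] is [O(k)], so this error has expectation [O(sqrt k)], and dividing by
    [J] gives the limit [1 / (n * mu)].  This needs neither memorylessness nor
    the measurability of the [J]-th update time. *)
Require Import Defs.
From HB Require Import structures.
From mathcomp Require Import all_boot all_order all_algebra.
From mathcomp Require Import finmap.
From mathcomp Require Import all_classical all_reals all_analysis.
From mathcomp Require Import measurable_realfun.
From mathcomp Require Import ring lra.

Set Implicit Arguments.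
Unset Strict Implicit.
Unset Printing Implicit Defensive.

Import Order.TTheory GRing.Theory Num.Theory.
Import numFieldNormedType.Exports.

Local Open Scope classical_set_scope.
Local Open Scope ring_scope.

(** * Integration against a density, and comparison with non-measurable integrands *)

Section integral_complements.
Local Open Scope ereal_scope.
Context d (T : measurableType d) (R : realType).
Implicit Types (mu nu : {measure set T -> \bar R}) (f g : T -> \bar R).

Import HBNNSimple.

(** Monotone convergence along the simple functions [h n] increasing to [f] reduces both sides to
    simple functions. These split over their level sets, where the hypothesis on [nu] applies
    directly. *)
Lemma ge0_integral_density mu nu (g : T -> R) :
    measurable_fun [set: T] g -> (forall x, 0 <= g x)%R ->
    (forall A, measurable A -> nu A = \int[mu]_(x in A) (g x)%:E) ->
  forall f : T -> \bar R, measurable_fun [set: T] f -> (forall x, 0 <= f x) ->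
  \int[nu]_x f x = \int[mu]_x (f x * (g x)%:E).
Proof.
move=> mg g0 nuE f mf f0; pose h := nnsfun_approx measurableT mf.
have hE x : limn (EFin \o h ^~ x) = f x.
  by apply/cvg_lim => //; apply: cvg_nnsfun_approx.
transitivity (limn (fun n => \int[nu]_x (h n x)%:E)).
  rewrite -monotone_convergence//.
  - by apply: eq_integral => x _; rewrite -hE.
  - by move=> n; exact/measurable_EFinP.
  - by move=> n x _; rewrite lee_fin.
  - by move=> x _ m n mn; rewrite lee_fin; exact/lefP/nd_nnsfun_approx.
transitivity (limn (fun n => \int[mu]_x ((h n x)%:E * (g x)%:E))); last first.
  rewrite -monotone_convergence//.
  - apply: eq_integral => x _; apply/cvg_lim => //; apply: cvgeZr => //.
    exact: cvg_nnsfun_approx.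
  - by move=> n; apply/measurable_EFinP/measurable_funM.
  - by move=> n x _; rewrite lee_fin mulr_ge0.
  - move=> x _ m n mn; rewrite lee_fin ler_wpM2r//.
    exact/lefP/nd_nnsfun_approx.
congr (limn _); apply/funext => n.
transitivity (\sum_(k \in range (h n))
    \int[nu]_x (k * \1_(h n @^-1` [set k]) x)%:E).
  under eq_integral do rewrite fimfunE -fsumEFin//.
  rewrite ge0_integral_fsum//.
  - by move=> r; apply/measurable_EFinP/measurable_funM.
  - by move=> r x _; rewrite nnfun_muleindic_ge0.
transitivity (\sum_(k \in range (h n))
    \int[mu]_x ((k * \1_(h n @^-1` [set k]) x)%:E * (g x)%:E)); last first.
  rewrite -ge0_integral_fsum//.
  - apply: eq_integral => x _; rewrite [in RHS]fimfunE -fsumEFin//.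
    by rewrite ge0_mule_fsuml// => r; exact: nnfun_muleindic_ge0.
  - move=> r; apply/measurable_EFinP/measurable_funM => //.
    exact: measurable_funM.
  - by move=> r x _; rewrite mule_ge0 ?lee_fin//; exact: nnfun_muleindic_ge0.
apply: eq_fsbigr => r /[!inE] -[x _ <-].
have mA : measurable (h n @^-1` [set h n x]) by exact: measurable_sfunP.
rewrite integralZl_indic_nnsfun// integral_indic// setIT nuE//.
rewrite integral_mkcond -ge0_integralZl//.
- apply: eq_integral => y _; rewrite EFinM -muleA patchE indicE.
  by case: (y \in _); rewrite ?mul1e ?mul0e.
- apply/(measurable_restrictT _ _).1 => //.
  exact/measurable_funTS/measurable_EFinP.
- by move=> y _; rewrite patchE; case: ifP; rewrite ?lee_fin.
- by rewrite lee_fin.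
Qed.

Let le_integral_funepos_aux mu f g : measurable_fun [set: T] g ->
  (forall x, 0 <= g x) -> {ae mu, forall x, f x <= g x} ->
  \int[mu]_x f^\+ x <= \int[mu]_x g x.
Proof.
move=> mg g0 fg; rewrite ge0_integralTE//.
apply: ge_ereal_sup => _ /= [h hf <-].
rewrite -integralT_nnsfun; apply: ae_ge0_le_integral => //.
- by move=> x _; rewrite lee_fin.
- exact/measurable_EFinP.
- apply: filterS fg => x fg _; rewrite (le_trans (hf x))//.
  by rewrite funeposE ge_max fg g0.
Qed.

(* Only the dominating function needs to be measurable: the integral of a
   nonnegative function is a supremum over the simple functions below it. *)
Lemma ae_le_integral mu f g : measurable_fun [set: T] g ->
  (forall x, 0 <= g x) -> {ae mu, forall x, f x <= g x} ->
  \int[mu]_x f x <= \int[mu]_x g x.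
Proof.
move=> mg g0 fg; rewrite integralE.
have := le_integral_funepos_aux mg g0 fg.
apply: le_trans; rewrite -[leRHS]sube0 leeB//.
exact: integral_ge0.
Qed.

(** Almost everywhere [f >= g >= 0], so the negative part of [f] integrates to 0. Cutting [g] to 0
    on a negligible set [N] keeps its integral, and then every simple function below it lies
    everywhere below the positive part of [f]. *)
Lemma ae_ge_integral mu f g : measurable_fun [set: T] g ->
  (forall x, 0 <= g x) -> {ae mu, forall x, g x <= f x} ->
  \int[mu]_x g x <= \int[mu]_x f x.
Proof.
move=> mg g0 gf; rewrite [leRHS]integralE.
have -> : \int[mu]_x f^\- x = 0.
  apply/eqP; rewrite eq_le integral_ge0//= andbT.
  rewrite -(integral0 mu setT).
  have : {ae mu, forall x, (\- f) x <= cst 0 x}.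
    by apply: filterS gf => x gf; rewrite /= oppe_le0 (le_trans _ gf).
  move/(@le_integral_funepos_aux mu (\- f) (cst 0)).
  rewrite funeposN; apply => //; exact: measurable_cst.
rewrite sube0; case: gf => N [mN N0 gfN].
rewrite (ge0_negligible_integral _ _ _ _ N0)//.
rewrite integral_mkcond !ge0_integralTE//; last first.
  by move=> x; rewrite patchE; case: ifP.
apply: ereal_sup_le => _ /= [h hg <-]; exists h => //.
move=> x; apply: (le_trans (hg x)); rewrite patchE setTD.
case: ifPn => [|_]; last by rewrite funeposE le_max lexx orbT.
rewrite inE/= => Nx; rewrite funeposE le_max; apply/orP; left.
by apply: contra_notT Nx => gfx; apply: gfN => /=; exact/negP.
Qed.

End integral_complements.

(** * Independent pairs are uncorrelated *)

Section independent_pairs.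
Local Open Scope ereal_scope.
Context d (T : measurableType d) (R : realType) (P : probability T R).

(** Independence on rectangles identifies the law of [(X, Y)] with the product of the two laws, by
    uniqueness of the product measure. Fubini then factors the integral of [z.1 * z.2]; square
    integrability makes that function integrable. *)
Lemma expectation_prod_indep (X Y : {RV P >-> R}) :
    (forall A B, measurable A -> measurable B ->
      P (X @^-1` A `&` Y @^-1` B) = P (X @^-1` A) * P (Y @^-1` B)) ->
  (X : T -> R) \in Lfun P 2%:E -> (Y : T -> R) \in Lfun P 2%:E ->
  'E_P[X * Y] = 'E_P[X] * 'E_P[Y].
Proof.
move=> XYindep X2 Y2.
have Pfin : P setT \is a fin_num := fin_num_measure P _ measurableT.
have /Lfun1_integrable X1 := Lfun_subset12 Pfin X2.
have /Lfun1_integrable Y1 := Lfun_subset12 Pfin Y2.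
have /Lfun1_integrable XY1 := Lfun2_mul_Lfun1 X2 Y2.
have mXY : measurable_fun [set: T] (fun w => (X w, Y w)).
  exact: measurable_fun_pair.
pose XY : {RV P >-> (R * R)%type} := mfun_Sub (mem_set mXY).
pose f (z : R * R) := (z.1 * z.2)%:E.
have mf : measurable_fun [set: R * R] f.
  by apply/measurable_EFinP; exact: measurable_funM.
have prodE A : measurable A ->
    (distribution P X \x distribution P Y) A = distribution P XY A.
  by apply: product_measure_unique => B C mB mC; exact: XYindep.
have fXY : P.-integrable [set: T] (f \o XY) by [].
have intf : (distribution P X \x distribution P Y).-integrable [set: R * R] f.
  apply/integrableP; split => //.
  rewrite (eq_measure_integral (distribution P XY)); last first.
    by move=> *; exact: prodE.
  rewrite ge0_integral_distribution//; last exact: measurableT_comp.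
  by case/integrableP : fXY.
have intX : (distribution P X).-integrable [set: R] EFin.
  exact: integrable_pushforward.
have intY : (distribution P Y).-integrable [set: R] EFin.
  exact: integrable_pushforward.
have EX : 'E_P[X] = \int[distribution P X]_x x%:E.
  by rewrite unlock integral_distribution.
have EY : 'E_P[Y] = \int[distribution P Y]_x x%:E.
  by rewrite unlock integral_distribution.
have EYfin : 'E_P[Y] \is a fin_num by rewrite EY integrable_fin_num.
transitivity (\int[distribution P XY]_z f z).
  by rewrite unlock integral_distribution.
rewrite (eq_measure_integral (distribution P X \x distribution P Y)); last first.
  by move=> A mA _; apply: esym; exact: prodE.
rewrite -integral12_prod_meas1// EX -(fineK EYfin).
rewrite -integralZr//; apply: eq_integral => x _.
by rewrite fineK// EY -integralZl//; apply: eq_integral => y _; rewrite -EFinM.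
Qed.

Lemma covariance_indep (X Y : {RV P >-> R}) :
    (forall A B, measurable A -> measurable B ->
      P (X @^-1` A `&` Y @^-1` B) = P (X @^-1` A) * P (Y @^-1` B)) ->
  (X : T -> R) \in Lfun P 2%:E -> (Y : T -> R) \in Lfun P 2%:E ->
  covariance P X Y = 0.
Proof.
move=> XYindep X2 Y2.
have Pfin : P setT \is a fin_num := fin_num_measure P _ measurableT.
have X1 := Lfun_subset12 Pfin X2; have Y1 := Lfun_subset12 Pfin Y2.
rewrite covarianceE//; last exact: Lfun2_mul_Lfun1.
by rewrite expectation_prod_indep// subee// fin_numM// expectation_fin_num.
Qed.

End independent_pairs.

(** * Variance of a sum of uncorrelated variables *)

Section variance_sum.
Local Open Scope ereal_scope.
Context d (T : measurableType d) (R : realType) (P : probability T R).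
Implicit Type X : nat -> T -> R.

Lemma covariance_suml X (Y : T -> R) n :
  (forall l, X l \in Lfun P 2%:E) -> Y \in Lfun P 2%:E ->
  covariance P (\sum_(l < n) X l)%R Y = \sum_(l < n) covariance P (X l) Y.
Proof.
move=> X2 Y2; elim: n => [|n IH]; first by rewrite !big_ord0 covariance_cst_l.
rewrite !big_ord_recr/= -IH covarianceDl//.
by rewrite rpred_sum ?lee1n.
Qed.

Lemma variance_sum_uncorrelated X n :
  (forall l, X l \in Lfun P 2%:E) ->
  (forall l k, (l < k)%N -> covariance P (X l) (X k) = 0) ->
  'V_P[(\sum_(l < n) X l)%R] = \sum_(l < n) 'V_P[X l].
Proof.
move=> X2 cov0; elim: n => [|n IH]; first by rewrite !big_ord0 variance_cst.
rewrite !big_ord_recr/= varianceD ?rpred_sum ?lee1n// IH.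
rewrite covariance_suml// [Y in _ + 2%:E * Y]big1 ?mule0 ?adde0// => l _.
exact: cov0.
Qed.

End variance_sum.

(** * Tail, exponential moment, mean and variance of the exponential law *)

Section exponential_law.
Context d (T : measurableType d) (R : realType) (P : probability T R).
Context (mu : R) (X : {RV P >-> R}).
Hypotheses (mu_gt0 : 0 < mu) (hX : exponentially_distributed mu X).

Lemma exponential_ae_ge0 : {ae P, forall w, 0 <= X w}.
Proof.
exists (X @^-1` `]-oo, 0[); split.
- by rewrite -[_ @^-1` _]setTI; exact: measurable_funP.
- rewrite -[LHS]/(distribution P X `]-oo, 0[) hX// /exponential_prob.
  rewrite integral0_eq// => x /=; rewrite in_itv/= => x0.
  by rewrite lt0_exponential_pdf.
- by move=> w /= /negP; rewrite -ltNge in_itv/=.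
Qed.

Let cdf_lt0 r : r < 0 -> cdf X r = 0%E.
Proof.
move=> r0; rewrite /cdf hX// /exponential_prob integral0_eq// => x /=.
by rewrite in_itv/= => xr; rewrite lt0_exponential_pdf// (le_lt_trans xr).
Qed.

Lemma exponential_ccdf r : 0 <= r -> ccdf X r = (expR (- mu * r))%:E.
Proof.
move=> r0; have := cdf_ccdf_1 X r.
have -> : cdf X r = (1 - (expR (- mu * r))%:E)%E.
  rewrite /cdf hX//.
  have -> : `]-oo, r]%classic = `]-oo, 0[ `|` `[0, r] :> set R.
    by rewrite -itv_bndbnd_setU// bnd_simp.
  rewrite /exponential_prob ge0_integral_setU//=; last 3 first.
  - apply/measurable_EFinP/measurable_funTS; exact: measurable_exponential_pdf.
  - by move=> x _; rewrite lee_fin exponential_pdf_ge0// ltW.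
  - apply/disj_setPLR => x /=; rewrite !in_itv/= => x0; apply/negP.
    by rewrite negb_and -ltNge x0.
  rewrite integral0_eq ?add0e; last first.
    by move=> x /=; rewrite in_itv/= => x0; rewrite lt0_exponential_pdf.
  move: r0; rewrite le_eqVlt => /predU1P[<-|r0].
    by rewrite set_itv1 integral_set1 mulr0 expR0 subee.
  exact: exponential_prob_itv0c.
case: (ccdf X r) => [c [ce]| |]; rewrite -?EFinB//.
by congr EFin; move: ce; lra.
Qed.

(** Multiplying the density of rate [mu] by [expR (mu / 2 * x)] gives twice the density of rate
    [mu / 2], which has total mass 1. *)
Lemma exponential_mgf_half : ('E_P[fun w => expR (mu / 2 * X w)] = 2%:E)%E.
Proof.
have mu2 : 0 < mu / 2 by rewrite divr_gt0.
have mX : @measurable_fun _ _ T (measurableTypeR R) [set: T] X.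
  by have mX := @measurable_funPT _ _ _ _ X; exact: mX.
(* [Y] is [X] with values viewed in [measurableTypeR R], so that its law can be compared with
   [lebesgue_measure]. *)
pose Y : {RV P >-> measurableTypeR R} :=
  @mfun_Sub _ _ T (measurableTypeR R) X (mem_set mX).
have mexpR : measurable_fun [set: R] (fun x : R => (expR (mu / 2 * x))%:E).
  by apply/measurable_EFinP/measurableT_comp => //; exact: measurable_funM.
have mexp : measurable_fun [set: measurableTypeR R]
    (fun x : measurableTypeR R => (expR (mu / 2 * x))%:E) by exact: mexpR.
rewrite unlock.
have <- := @ge0_integral_distribution _ _ _ _ _ P Y _ mexp; last first.
  by move=> x; rewrite lee_fin expR_ge0.
rewrite (@ge0_integral_density _ _ _ lebesgue_measure
  (distribution P Y) (exponential_pdf mu))//.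
- transitivity (\int[lebesgue_measure]_x
      (2%:E * (exponential_pdf (mu / 2) x)%:E))%E.
    apply: eq_integral => x _; rewrite -!EFinM; congr EFin.
    have [x0|x0] := leP 0 x; last by rewrite !lt0_exponential_pdf// !mulr0.
    rewrite !exponential_pdfE// mulrCA -expRD mulrA [2 * _]mulrC divfK//.
    by congr (_ * expR _); lra.
  rewrite ge0_integralZl// ?integral_exponential_pdf ?mule1//.
  + by apply/measurable_EFinP; exact: measurable_exponential_pdf.
  + by move=> x _; rewrite lee_fin exponential_pdf_ge0// ltW.
- exact: measurable_exponential_pdf.
- by move=> x; rewrite exponential_pdf_ge0// ltW.
Qed.

(** With [u = mu * x / 4], this is the square of [u <= expR u]. It makes the second moment finite
    through the exponential moment at [mu / 2]. *)
Let sqr_le_exp x : 0 <= x -> x ^+ 2 <= 16 / mu ^+ 2 * expR (mu / 2 * x).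
Proof.
move=> x0; have -> : mu / 2 * x = mu * x / 4 + mu * x / 4 by lra.
have mux : 0 <= mu * x / 4 by rewrite divr_ge0// mulr_ge0// ltW.
have -> : x ^+ 2 = 16 / mu ^+ 2 * (mu * x / 4) ^+ 2.
  by field; rewrite gt_eqF.
rewrite expRD -expr2 ler_wpM2l ?divr_ge0 ?sqr_ge0//.
rewrite lerXn2r ?nnegrE ?expR_ge0// (le_trans _ (expR_ge1Dx _))//.
by rewrite lerDr.
Qed.

Let integral_sqr_le : (\int[P]_w (X w ^+ 2)%:E <= (32 / mu ^+ 2)%:E)%E.
Proof.
have mexp : measurable_fun [set: T] (fun w => (expR (mu / 2 * X w))%:E).
  by apply/measurable_EFinP/measurableT_comp => //; exact: measurable_funM.
apply: (@le_trans _ _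
    (\int[P]_w ((16 / mu ^+ 2)%:E * (expR (mu / 2 * X w))%:E))%E).
  apply: ae_le_integral.
  - exact: emeasurable_funM.
  - by move=> w; rewrite mule_ge0// lee_fin ?expR_ge0// divr_ge0// sqr_ge0.
  - apply: filterS exponential_ae_ge0 => w Xw.
    by rewrite -EFinM lee_fin sqr_le_exp.
rewrite ge0_integralZl//; last first.
  by rewrite lee_fin divr_ge0// sqr_ge0.
have := exponential_mgf_half; rewrite unlock => ->.
by rewrite -EFinM lee_fin; lra.
Qed.

Lemma exponential_Lfun2 : (X : T -> R) \in Lfun P 2%:E.
Proof.
rewrite inE; apply/andP; split; rewrite inE//= /finite_norm unlock /Lnorm.
rewrite poweR_lty//=.
under eq_integral do rewrite (powR_mulrn 2)// -normrX ger0_norm ?sqr_ge0//.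
exact: le_lt_trans integral_sqr_le (ltry _).
Qed.

Lemma exponential_variance_le : ('V_P[X] <= (32 / mu ^+ 2)%:E)%E.
Proof.
rewrite varianceE; last exact: exponential_Lfun2.
rewrite (le_trans _ integral_sqr_le)//.
rewrite [Y in ('E__[Y])%E](_ : _ = fun w => X w ^+ 2)//.
by rewrite unlock -[leRHS]sube0 leeB// sqre_ge0.
Qed.

(** The mean is the integral of the tail over the positive half-line, and the tail is [mu^-1] times
    the density. *)
Lemma exponential_expectation : ('E_P[X] = (mu^-1)%:E)%E.
Proof.
have X1 : (X : T -> R) \in Lfun P 1.
  apply: Lfun_subset12; last exact: exponential_Lfun2.
  exact: fin_num_measure P _ measurableT.
rewrite expectation_cdf_ccdf//.
rewrite [X in (_ - X)%E]integral0_eq ?sube0; last first.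
  by move=> r /=; rewrite in_itv/= => r0; rewrite cdf_lt0.
transitivity (\int[lebesgue_measure]_x
    ((mu^-1)%:E * (exponential_pdf mu x)%:E))%E.
  rewrite integral_mkcond; apply: eq_integral => r _.
  rewrite patchE; case: ifPn => [|].
    rewrite inE/= in_itv/= andbT => r0; rewrite exponential_ccdf//.
    by rewrite exponential_pdfE// -EFinM mulrA mulVf ?mul1r// gt_eqF.
  move=> /negP; rewrite inE/= in_itv/= andbT => /negP; rewrite -ltNge => r0.
  by rewrite lt0_exponential_pdf// mule0.
rewrite ge0_integralZl//.
- by rewrite integral_exponential_pdf// mule1.
- by apply/measurable_EFinP; exact: measurable_exponential_pdf.
- by move=> x _; rewrite lee_fin exponential_pdf_ge0// ltW.
- by rewrite lee_fin invr_ge0 ltW.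
Qed.

End exponential_law.

(** * Pairs and finite subfamilies of a mutually independent family *)

Section mutual_independence.
Context d (T : measurableType d) (R : realType) (P : probability T R).

Lemma mutually_independent_pair (I : choiceType) (X : I -> {RV P >-> R}) :
  mutually_independent X -> forall a b, a != b ->
  forall A B, measurable A -> measurable B ->
  (P (X a @^-1` A `&` X b @^-1` B) = P (X a @^-1` A) * P (X b @^-1` B))%E.
Proof.
move=> indepX a b ab A B mA mB.
pose C c := if c == a then A else B.
have mC c : measurable (C c) by rewrite /C; case: ifP.
have Ca : C a = A by rewrite /C eqxx.
have Cb : C b = B by rewrite /C eq_sym (negbTE ab).
have := indepX [fset a; b]%fset C mC.
rewrite big_fsetU1 ?inE//= big_seq_fset1 Ca Cb => <-; congr (P _).
apply/seteqP; split => [w [Xa Xb] c /=|w /= Cw].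
  by rewrite !inE => /orP[]/eqP ->; rewrite ?Ca ?Cb.
by split; [rewrite -Ca|rewrite -Cb]; apply: Cw; rewrite /= !inE eqxx ?orbT.
Qed.

Lemma mutually_independent_fin (n : nat) (I : choiceType) (f : 'I_n -> I)
    (X : I -> {RV P >-> R}) : mutually_independent X -> injective f ->
  forall A, measurable A ->
  (P (\bigcap_i (X (f i) @^-1` A)) = \prod_(i < n) P (X (f i) @^-1` A))%E.
Proof.
move=> indepX f_inj A mA.
have := indepX [fset f i | i in 'I_n]%fset (fun=> A) (fun=> mA).
rewrite big_imfset/=; last by move=> i k _ _ /f_inj.
rewrite big_enum/= => <-; congr (P _).
apply/seteqP; split => [w /= Xw a /= /imfsetP[i _ ->]|w /= Xw i _].
  exact: Xw.
by apply: Xw => /=; apply/imfsetP; exists i.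
Qed.

End mutual_independence.

(** * Logarithmic bounds on the synchronous runtime *)

Section synchronous.
Context d (T : measurableType d) (R : realType) (P : probability T R).
Context (n : nat) (X : 'I_n -> nat -> {RV P >-> R}) (mu : R).
Hypotheses (mu_gt0 : 0 < mu) (hX : iid_exponential X mu) (n_gt0 : (0 < n)%N).

Let n_gt0R : 0 < n%:R :> R. Proof. by rewrite ltr0n. Qed.

Let ln_n_ge0 : 0 <= ln n%:R :> R. Proof. by rewrite ln_ge0// ler1n. Qed.

Let sync_runtime_ge0 j w : 0 <= sync_runtime X j w.
Proof. by rewrite /sync_runtime bigmax_ge_id. Qed.

(* [1 + z <= exp z] at [z = mu / 2 * X i j - ln n] bounds every [X i j], hence
   their maximum. *)
Lemma expected_sync_runtime_le j :
  (expected_sync_runtime X j <= (2 / mu * (ln n%:R + 2))%:E)%E.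
Proof.
pose Y w := \sum_(i < n) expR (mu / 2 * X i j w).
have mY i : measurable_fun [set: T] (fun w => (expR (mu / 2 * X i j w))%:E).
  by apply/measurable_EFinP/measurableT_comp => //; exact: measurable_funM.
have intY : (\int[P]_w (Y w)%:E = (2 * n%:R)%:E)%E.
  under eq_integral do rewrite -sumEFin.
  rewrite ge0_integral_sum//.
  under eq_bigr.
    move=> i _.
    have := exponential_mgf_half mu_gt0 (hX.2 i j); rewrite unlock => ->.
    over.
  by rewrite sumEFin sumr_const card_ord mulr_natr.
have mYs : measurable_fun [set: T] (fun w => (Y w)%:E).
  apply/measurable_EFinP; apply: measurable_sum => i.
  by have /measurable_EFinP := mY i.
have Y0 w : 0 <= Y w by rewrite sumr_ge0// => i _; rewrite expR_ge0.
apply: (@le_trans _ _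
    (\int[P]_w ((2 / mu * ln n%:R)%:E + (2 / mu / n%:R)%:E * (Y w)%:E))%E).
  rewrite /expected_sync_runtime unlock; apply: ae_le_integral.
  - by apply: emeasurable_funD => //; exact: emeasurable_funM.
  - move=> w; rewrite -EFinM -EFinD lee_fin addr_ge0// mulr_ge0//.
      by rewrite divr_ge0// ltW.
    by rewrite divr_ge0// divr_ge0// ltW.
  - apply: aeW => w; rewrite -EFinM -EFinD lee_fin; apply/bigmax_leP; split.
      rewrite addr_ge0// mulr_ge0//; first by rewrite divr_ge0// ltW.
      by rewrite divr_ge0// divr_ge0// ltW.
    move=> i _.
    have -> : 2 / mu * ln n%:R + 2 / mu / n%:R * Y w =
        (ln n%:R + Y w / n%:R) / (mu / 2) by field; rewrite !gt_eqF.
    rewrite ler_pdivlMr ?divr_gt0// [leLHS]mulrC.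
    have := expR_ge1Dx (mu / 2 * X i j w - ln n%:R).
    rewrite expRD expRN lnK ?posrE// => h.
    have : expR (mu / 2 * X i j w) <= Y w.
      by rewrite /Y (bigD1 i)//= lerDl sumr_ge0// => k _; rewrite expR_ge0.
    rewrite -(ler_pM2r (_ : 0 < n%:R^-1)) ?invr_gt0// => h2.
    lra.
rewrite ge0_integralD//; last 3 first.
- by move=> w _; rewrite lee_fin mulr_ge0// divr_ge0// ltW.
- by move=> w _; rewrite mule_ge0// lee_fin// divr_ge0// divr_ge0// ltW.
- exact: emeasurable_funM.
rewrite integral_cst// [X in (_ * X)%E]probability_setT mule1.
rewrite ge0_integralZl//; last 2 first.
- by move=> w _; rewrite lee_fin.
- by rewrite lee_fin divr_ge0// divr_ge0// ltW.
rewrite intY -EFinM -EFinD lee_fin le_eqVlt; apply/orP; left; apply/eqP.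
by field; rewrite !gt_eqF.
Qed.

Lemma expected_sync_runtime_ge j :
  ((ln n%:R / (2 * mu))%:E <= expected_sync_runtime X j)%E.
Proof.
(* At this level the tail probability of each worker is exactly [1 / n]; [E] is the event that no
   worker exceeds it. *)
pose t : R := ln n%:R / mu.
have t0 : 0 <= t by rewrite divr_ge0// ltW.
pose E := \bigcap_(i : 'I_n) (X i j @^-1` `]-oo, t]).
have mE : measurable E.
  apply: fin_bigcap_measurable => // i _.
  by rewrite -[_ @^-1` _]setTI; exact: measurable_funP.
have PE : (P E = ((1 - n%:R^-1) ^+ n)%:E)%E.
  have inj : injective (fun i : 'I_n => (i, j)) by move=> ? ? [].
  rewrite /E (mutually_independent_fin hX.1 inj)//.
  rewrite (eq_bigr (fun=> (1 - n%:R^-1)%:E)).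
    by rewrite prodEFin prodr_const card_ord.
  move=> i _; rewrite -[LHS]/(cdf (X i j) t).
  have := cdf_ccdf_1 (X i j) t; rewrite (exponential_ccdf mu_gt0 (hX.2 i j))//.
  rewrite mulNr mulrCA divff ?gt_eqF// mulr1 expRN lnK ?posrE//.
  case: (cdf _ _) => [c| |]//; rewrite -EFinD => -[ce].
  by congr EFin; move: ce; lra.
have PE2 : (1 - n%:R^-1) ^+ n <= 2^-1 :> R.
  have h1 : 1 - n%:R^-1 <= expR (- n%:R^-1) :> R by exact: expR_ge1Dx.
  apply: (@le_trans _ _ (expR (- n%:R^-1) ^+ n)).
    by rewrite lerXn2r ?nnegrE ?expR_ge0// subr_ge0 invf_le1// ler1n.
  rewrite -expRM_natl mulrN divff ?gt_eqF// expRN.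
  (* The power is at most [expR (- 1)], and [expR 1 >= 1 + 1]. *)
  by rewrite lef_pV2 ?posrE ?expR_gt0//; have := expR_ge1Dx (1 : R); lra.
(* As in Markov's inequality, the maximum is at least [t] off [E] and nonnegative on [E]. *)
apply: (@le_trans _ _ (\int[P]_w (t * \1_(~` E) w)%:E)%E); last first.
  rewrite /expected_sync_runtime unlock; apply: ae_ge_integral.
  - apply/measurable_EFinP/measurable_funM => //.
    by apply: measurable_indic; exact: measurableC.
  - by move=> w; rewrite lee_fin mulr_ge0.
  - apply: aeW => w; rewrite lee_fin indicE.
    have [|_] := boolP (w \in ~` E); last first.
      by rewrite mulr0 sync_runtime_ge0.
    rewrite inE mulr1 => /existsNP[i /not_implyP[_ /=]].
    rewrite in_itv/= => /negP; rewrite -ltNge => /ltW tX.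
    by rewrite (le_trans tX)// /sync_runtime; apply: le_bigmax.
under eq_integral do rewrite EFinM.
rewrite ge0_integralZl//; last first.
  by apply/measurable_EFinP/measurable_indic; exact: measurableC.
rewrite integral_indic; [|exact: measurableT|exact: measurableC].
rewrite setIT [X in (_ * X)%E](_ : _ = 1 - P E)%E; last first.
  exact: probability_setC.
rewrite PE -EFinB -EFinM lee_fin.
rewrite invfM mulrA mulrAC -/t ler_wpM2l//; lra.
Qed.

End synchronous.

(** * Deterministic bounds on the update time, for one outcome *)

Section order_statistic.
Local Open Scope card_scope.
Context (R : realType) (n : nat) (x : 'I_n -> nat -> R) (J k : nat) (m : R).
Hypotheses (x_ge0 : forall i l, 0 <= x i l).
Hypotheses (n_gt0 : (0 < n)%N) (nkJ : (n * k < J)%N) (Jnk : (J <= n * k.+1)%N).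

(** For a fixed outcome, [tm] is the push time and [A] the set whose infimum is the update time. The
    centre [m] is arbitrary here and will be the mean of [tm i k]. *)
Let tm i k := \sum_(l < k.+1) x i l.
Let Z := \sum_(i < n) `|tm i k - m|.
Let A := [set t | `I_J #<= [set a : 'I_n * nat | tm a.1 a.2 <= t]].

Let tm_le i k1 k2 : (k1 <= k2)%N -> tm i k1 <= tm i k2.
Proof.
move=> k12; rewrite /tm -!(big_mkord xpredT (x i)).
by rewrite [leRHS](@big_cat_nat _ _ _ k1.+1)//= lerDl sumr_ge0.
Qed.

Let tm_ge0 i l : 0 <= tm i l. Proof. by rewrite sumr_ge0. Qed.

(* If [t < tm i k] for every [i], at most [k] pushes of each worker have
   occurred by time [t], which makes at most [n * k < J] of them. *)
Let A_ge t : A t -> exists i, tm i k <= t.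
Proof.
rewrite /A/= => At; apply: contrapT => /forallNP tk.
have : `I_J #<= `I_(n * k).
  apply: (card_le_trans At).
  (* Euclidean division by [k] enumerates the pairs [(i, l)] with [l < k]; the default of [insubd]
     is never reached when [j < n * k]. *)
  pose h j : 'I_n * nat := (insubd (Ordinal n_gt0) (j %/ k)%N, (j %% k)%N).
  apply: (card_le_trans (subset_card_le _) (card_image_le h _)).
  move=> [i l] /= til.
  have lk : (l < k)%N.
    rewrite ltnNge; apply/negP => kl; apply: (tk i).
    by apply: le_trans til; exact: tm_le.
  exists (i * k + l)%N => /=.
    rewrite (@leq_trans (i * k + k)%N) ?ltn_add2l//.
    by rewrite addnC -mulSn leq_mul2r ltn_ord orbT.
  have k0 : (0 < k)%N by apply: leq_trans lk.
  rewrite /h divnMDl// divn_small// addn0 modnMDl modn_small//.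
  by congr pair; apply: val_inj; rewrite val_insubd ltn_ord.
by rewrite card_le_II leqNgt nkJ.
Qed.

(** Each worker has then made at least [k.+1] pushes, so at least [n * k.+1 >= J] in all. The code
    [i * k.+1 + l] of these pairs covers [I_J]. *)
Let A_le t : (forall i, tm i k <= t) -> A t.
Proof.
move=> tk; rewrite /A/=.
pose h (a : 'I_n * nat) := (a.1 * k.+1 + a.2)%N.
apply: (card_le_trans (subset_card_le _) (card_image_le h _)).
move=> j /= jJ.
have jn : (j %/ k.+1 < n)%N.
  by rewrite ltn_divLR// (leq_trans jJ).
exists (Ordinal jn, j %% k.+1)%N; last by rewrite /h/= -divn_eq.
by rewrite /= (le_trans _ (tk (Ordinal jn)))// tm_le// -ltnS ltn_pmod.
Qed.

Let Z_ge i : `|tm i k - m| <= Z.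
Proof. by rewrite /Z (bigD1 i)//= lerDl sumr_ge0. Qed.

Let A_Z : A (m + Z).
Proof.
by apply: A_le => i; rewrite -lerBlDl (le_trans (ler_norm _))// Z_ge.
Qed.

Lemma inf_counting_le : inf A <= m + Z.
Proof.
apply: ge_inf => //; exists 0 => t /A_ge[i]; exact: le_trans.
Qed.

(** Every [t] in [A] is above some [tm i k], which is nonnegative and within [Z] of [m]. The maximum
    with 0 provides the nonnegative minorant that [ae_ge_integral] asks for. *)
Lemma inf_counting_ge : Num.max 0 (m - Z) <= inf A.
Proof.
apply: lb_le_inf; first by exists (m + Z).
move=> t /A_ge[i tk]; rewrite ge_max (le_trans _ tk)//= (le_trans _ tk)//.
by rewrite lerBlDr -lerBlDl (le_trans _ (Z_ge i))// distrC ler_norm.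
Qed.

End order_statistic.

(** * Limit of the mean asynchronous runtime *)

Section asynchronous.
Context d (T : measurableType d) (R : realType) (P : probability T R).
Context (n : nat) (X : 'I_n -> nat -> {RV P >-> R}) (mu : R).
Hypotheses (mu_gt0 : 0 < mu) (hX : iid_exponential X mu) (n_gt0 : (0 < n)%N).

Let n_gt0R : 0 < n%:R :> R. Proof. by rewrite ltr0n. Qed.

Let X2 i l : (X i l : T -> R) \in Lfun P 2%:E.
Proof. exact: exponential_Lfun2 mu_gt0 (hX.2 i l). Qed.

Let push_timeE i k : push_time X i k = \sum_(l < k.+1) (X i l : T -> R).
Proof. by apply/funext => w; rewrite fct_sumE. Qed.

Let push_time2 i k : push_time X i k \in Lfun P 2%:E.
Proof. by rewrite push_timeE rpred_sum ?lee1n. Qed.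

Lemma measurable_push_time i k : measurable_fun [set: T] (push_time X i k).
Proof. by have := push_time2 i k; rewrite inE => /andP[]; rewrite inE. Qed.

Lemma expectation_push_time i k :
  ('E_P[push_time X i k] = (k.+1%:R / mu)%:E)%E.
Proof.
rewrite push_timeE; elim: (k.+1) => [|l IH].
  by rewrite big_ord0 expectation_cst mul0r.
have Pfin : P setT \is a fin_num := fin_num_measure P _ measurableT.
rewrite big_ord_recr/= expectationD; last 2 first.
- by apply: (Lfun_subset12 Pfin); rewrite rpred_sum ?lee1n.
- exact: Lfun_subset12 Pfin _ (X2 i l).
rewrite IH (exponential_expectation mu_gt0 (hX.2 i l)) -EFinD.
by rewrite -natr1 mulrDl mul1r.
Qed.

Lemma variance_push_time_le i k :
  ('V_P[push_time X i k] <= (k.+1%:R * (32 / mu ^+ 2))%:E)%E.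
Proof.
rewrite push_timeE (variance_sum_uncorrelated (X := fun l => X i l))//; last first.
  move=> l1 l2 l12; apply: covariance_indep => // A B mA mB.
  apply: (mutually_independent_pair hX.1 (a := (i, l1)) (b := (i, l2))) => //.
  by rewrite xpair_eqE eqxx/= ltn_eqF.
apply: (@le_trans _ _ (\sum_(l < k.+1) (32 / mu ^+ 2)%:E)%E).
  by apply: lee_sum => l _; exact: exponential_variance_le mu_gt0 (hX.2 i l).
by rewrite sumEFin sumr_const card_ord -[X in (X%:E <= _)%E]mulr_natl.
Qed.

Let D : R := (32 / mu ^+ 2 + 1) / 2.

Let D_ge0 : 0 <= D.
Proof. by rewrite divr_ge0// addr_ge0// divr_ge0// sqr_ge0. Qed.

(** With [s] the square root of [k.+1] and [Y] the centred push time,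
    [|Y| <= Y ^+ 2 / (2 * s) + s / 2], the difference being a square. Integrating, the variance
    bound [s ^+ 2 * (32 / mu ^+ 2)] gives exactly [D * s]. *)
Lemma expectation_push_time_dist_le i k :
  (\int[P]_w `|push_time X i k w - k.+1%:R / mu|%:E <=
    (D * Num.sqrt k.+1%:R)%:E)%E.
Proof.
set s := Num.sqrt _; have s0 : 0 < s by rewrite sqrtr_gt0 ltr0n.
have ss : k.+1%:R = s * s by rewrite -expr2 sqr_sqrtr// ler0n.
pose Y w := push_time X i k w - k.+1%:R / mu.
have mY : measurable_fun [set: T] Y.
  by apply: measurable_funB => //; exact: measurable_push_time.
have mY2 : measurable_fun [set: T] (fun w => (Y w ^+ 2)%:E).
  by apply/measurable_EFinP; exact: measurable_funX.
have Y2E : (\int[P]_w (Y w ^+ 2)%:E = 'V_P[push_time X i k])%E.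
  rewrite /variance unlock expectation_push_time/= unlock.
  by apply: eq_integral.
apply: (@le_trans _ _
    (\int[P]_w ((2 * s)^-1%:E * (Y w ^+ 2)%:E + (s / 2)%:E))%E).
  apply: ge0_le_integral => //.
  - by apply/measurable_EFinP; exact: measurableT_comp.
  - by apply: emeasurable_funD => //; exact: emeasurable_funM.
  - move=> w _; rewrite -/(Y w) -EFinM -EFinD lee_fin -subr_ge0.
    have -> : (2 * s)^-1 * Y w ^+ 2 + s / 2 - `|Y w| =
        (2 * s)^-1 * (`|Y w| - s) ^+ 2.
      by rewrite -(real_normK (num_real (Y w))); field; rewrite gt_eqF.
    by rewrite mulr_ge0 ?sqr_ge0// invr_ge0 mulr_ge0// ltW.
rewrite ge0_integralD//; last 3 first.
- move=> w _; rewrite -EFinM lee_fin mulr_ge0 ?sqr_ge0// invr_ge0 mulr_ge0//.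
  exact: ltW.
- exact: emeasurable_funM.
- by move=> w _; rewrite lee_fin divr_ge0// ltW.
rewrite integral_cst// [X in (_ * X)%E]probability_setT mule1.
rewrite ge0_integralZl//; last 2 first.
- by move=> w _; rewrite lee_fin sqr_ge0.
- by rewrite lee_fin invr_ge0 mulr_ge0// ltW.
rewrite Y2E (@le_trans _ _ ((2 * s)^-1%:E * (k.+1%:R * (32 / mu ^+ 2))%:E
  + (s / 2)%:E)%E)//.
  rewrite leeD// lee_wpmul2l ?variance_push_time_le//.
  by rewrite lee_fin invr_ge0 mulr_ge0// ltW.
rewrite -EFinM -EFinD lee_fin ss /D le_eqVlt; apply/orP; left; apply/eqP.
by field; rewrite !gt_eqF.
Qed.

Let Z k w := \sum_(i < n) `|push_time X i k w - k.+1%:R / mu|.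

Let Z_ge0 k w : 0 <= Z k w. Proof. exact: sumr_ge0. Qed.

Let mZ k : measurable_fun [set: T] (fun w => (Z k w)%:E).
Proof.
apply/measurable_EFinP/measurable_sum => i; apply: measurableT_comp => //.
by apply: measurable_funB => //; exact: measurable_push_time.
Qed.

Let integral_Z_le k :
  (\int[P]_w (Z k w)%:E <= (n%:R * (D * Num.sqrt k.+1%:R))%:E)%E.
Proof.
under eq_integral do rewrite -sumEFin.
rewrite ge0_integral_sum//; last first.
  move=> i; apply/measurable_EFinP/measurableT_comp => //.
  by apply: measurable_funB => //; exact: measurable_push_time.
apply: (@le_trans _ _ (\sum_(i < n) (D * Num.sqrt k.+1%:R)%:E)%E).
  by apply: lee_sum => i _; exact: expectation_push_time_dist_le.
by rewrite sumEFin sumr_const card_ord -[X in (X%:E <= _)%E]mulr_natl.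
Qed.

Let ae_X_ge0 : {ae P, forall w, forall i l, 0 <= X i l w}.
Proof.
apply: filter_forall => i; apply: ae_foralln => l.
exact: exponential_ae_ge0 (hX.2 i l).
Qed.

Let B k : R := n%:R * (D * Num.sqrt k.+1%:R).

Lemma expectation_update_time_le J k : (n * k < J <= n * k.+1)%N ->
  ('E_P[async_update_time X J] <= (k.+1%:R / mu + B k)%:E)%E.
Proof.
move=> /andP[nkJ Jnk].
apply: (@le_trans _ _ (\int[P]_w ((k.+1%:R / mu)%:E + (Z k w)%:E))%E).
  rewrite unlock; apply: ae_le_integral.
  - exact: emeasurable_funD.
  - by move=> w; rewrite adde_ge0 ?lee_fin// divr_ge0// ltW.
  - apply: filterS ae_X_ge0 => w Xw; rewrite -EFinD lee_fin.
    exact: (@inf_counting_le _ _ (fun i l => X i l w)).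
rewrite ge0_integralD//; last 2 first.
- by move=> w _; rewrite lee_fin divr_ge0// ltW.
- by move=> w _; rewrite lee_fin.
rewrite integral_cst// [X in (_ * X + _)%E]probability_setT mule1.
by rewrite EFinD leeD.
Qed.

(** The update time dominates [L] almost surely, and [L + Z k >= k.+1 / mu] pointwise; it remains to
    subtract the bound [B k] on the expectation of [Z k]. *)
Lemma expectation_update_time_ge J k : (n * k < J <= n * k.+1)%N ->
  ((k.+1%:R / mu - B k)%:E <= 'E_P[async_update_time X J])%E.
Proof.
move=> /andP[nkJ Jnk].
pose L w := Num.max 0 (k.+1%:R / mu - Z k w).
have mL : measurable_fun [set: T] (fun w => (L w)%:E).
  apply/measurable_EFinP/measurable_maxr => //; apply: measurable_funB => //.
  by have /measurable_EFinP := mZ k.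
have L0 w : 0 <= L w by rewrite le_max lexx.
apply: (@le_trans _ _ (\int[P]_w (L w)%:E)%E); last first.
  rewrite unlock; apply: ae_ge_integral => //.
  apply: filterS ae_X_ge0 => w Xw; rewrite lee_fin.
  exact: (@inf_counting_ge _ _ (fun i l => X i l w)).
rewrite EFinB leeBlDr//.
apply: (@le_trans _ _ (\int[P]_w (L w)%:E + \int[P]_w (Z k w)%:E)%E); last first.
  exact: leeD.
rewrite -ge0_integralD//; last 2 first.
- by move=> w _; rewrite lee_fin.
- by move=> w _; rewrite lee_fin.
apply: (@le_trans _ _ (\int[P]_w (k.+1%:R / mu)%:E)%E).
  by rewrite integral_cst// [X in (_ * X)%E]probability_setT mule1.
apply: ge0_le_integral => //.
- by move=> w _; rewrite lee_fin divr_ge0// ltW.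
- exact: emeasurable_funD.
- by move=> w _; rewrite -EFinD lee_fin -lerBlDr le_max lexx orbT.
Qed.

Lemma mean_async_runtime_cvg :
  mean_async_runtime X @ \oo --> ((n%:R * mu)^-1)%:E.
Proof.
(* The first term accounts for the fluctuations, at most [n * D * sqrt J]. The second accounts for
   replacing [J / n] by [k.+1], an error of at most [mu^-1], hence of [mu^-1 * sqrt J] as
   [J >= 1]. *)
pose C : R := n%:R * D + mu^-1.
have mu_inv_ge0 : 0 <= mu^-1 by rewrite invr_ge0 ltW.
have C0 : 0 <= C by rewrite addr_ge0// mulr_ge0.
have bound J : (0 < J)%N -> mean_async_runtime X J \is a fin_num /\
    `|fine (mean_async_runtime X J) - (n%:R * mu)^-1| <= C / Num.sqrt J%:R.
  (* Dividing [J.-1] rather than [J] makes the lower bound [n * k < J] strict and allows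
     [J = n * k.+1]. *)
  move=> J0; set k := (J.-1 %/ n)%N.
  have kJ : (n * k < J <= n * k.+1)%N.
    rewrite -(prednK J0) ltnS mulnC leq_trunc_div/= [(n * _)%N]mulnC.
    by rewrite -ltnS ltnS ltn_ceil.
  have := expectation_update_time_le kJ; have := expectation_update_time_ge kJ.
  rewrite /mean_async_runtime inver pnatr_eq0 gtn_eqF//.
  case: ('E_P[_])%E => [e| |]//; rewrite !lee_fin => eB eB2.
  split => //=.
  have Jpos : 0 < J%:R :> R by rewrite ltr0n.
  set s := Num.sqrt J%:R; have s0 : 0 < s by rewrite sqrtr_gt0.
  have ss : J%:R = s * s by rewrite -expr2 sqr_sqrtr// ltW.
  have s1 : 1 <= s by rewrite -[1]sqrtr1 ler_wsqrtr// ler1n.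
  have ks : Num.sqrt k.+1%:R <= s.
    rewrite ler_wsqrtr// ler_nat; case/andP : kJ => nkJ _.
    by rewrite (leq_ltn_trans _ nkJ)// leq_pmull.
  have {}eB3 : `|e - k.+1%:R / mu| <= n%:R * D * s.
    have BB : B k <= n%:R * D * s by rewrite /B mulrA ler_wpM2l// mulr_ge0.
    by rewrite ler_norml; apply/andP; split; lra.
  have kJmu : `|k.+1%:R / mu - J%:R / (n%:R * mu)| <= mu^-1.
    have -> : k.+1%:R / mu - J%:R / (n%:R * mu) =
        (n%:R * k.+1%:R - J%:R) / n%:R / mu :> R.
      by field; rewrite !gt_eqF.
    case/andP : kJ => nkJ Jnk.
    have h1 : J%:R <= n%:R * k.+1%:R :> R by rewrite -natrM ler_nat.
    have h2 : n%:R * k.+1%:R - J%:R <= n%:R :> R.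
      rewrite -natr1 mulrDr mulr1 lerBlDr addrC lerD2l -natrM ler_nat.
      exact: ltnW.
    rewrite ger0_norm; last first.
      by rewrite !divr_ge0 ?subr_ge0// ltW.
    rewrite -[X in _ <= X]mul1r ler_wpM2r ?invr_ge0 ?(ltW mu_gt0)//.
    by rewrite ler_pdivrMr// mul1r.
  have -> : e / J%:R - (n%:R * mu)^-1 =
      ((e - k.+1%:R / mu) + (k.+1%:R / mu - J%:R / (n%:R * mu))) / J%:R.
    by field; rewrite !gt_eqF.
  rewrite normrM (gtr0_norm (_ : 0 < J%:R^-1)) ?invr_gt0// ler_pdivrMr//.
  have -> : C / s * J%:R = n%:R * D * s + mu^-1 * s.
    by rewrite ss /C; field; rewrite !gt_eqF.
  rewrite (le_trans (ler_normD _ _))//.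
  by rewrite lerD// (le_trans kJmu)// ler_peMr.
apply/fine_cvgP; split.
  by exists 1 => // J /= J0; have [] := bound J J0.
apply/cvgrPdist_le => eps eps0; near=> J.
have J0 : (0 < J)%N by near: J; exists 1.
have [_] := bound J J0; rewrite distrC => /le_trans; apply.
rewrite ler_pdivrMr ?sqrtr_gt0 ?ltr0n// -ler_pdivrMl//.
have epsC0 : 0 <= eps^-1 * C by rewrite mulr_ge0// invr_ge0 ltW.
(* Writing [C / eps] as the square root of its square turns the goal into [J >= (C / eps) ^+ 2]. *)
rewrite -(ger0_norm epsC0).
rewrite -sqrtr_sqr ler_wsqrtr//.
near: J; exact: nbhs_infty_ger.
Unshelve. all: by end_near. Qed.

End asynchronous.

(** * Order of growth of the ratio *)

Theorem corollary1 (R : realType) (mu : R) (hmu : 0 < mu)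
    (d : nat -> measure_display)
    (Omega : forall P : nat, measurableType (d P))
    (Pr : forall P : nat, probability (Omega P) R)
    (X : forall P : nat, 'I_P -> nat -> {RV (Pr P) >-> R})
    (hX : forall P : nat, iid_exponential (@X P) mu)
    (j : nat) :
  (forall P : nat, (0 < P)%N ->
     [/\ expected_sync_runtime (@X P) j \is a fin_num,
         cvgn (mean_async_runtime (@X P)),
         expected_async_runtime (@X P) \is a fin_num
       & expected_async_runtime (@X P) != 0%E])
  /\
  (fun P : nat => fine (expected_sync_runtime (@X P) j /
                        expected_async_runtime (@X P))%E : R)
    =Theta_\oo (fun P : nat => P%:R * ln (P%:R) : R).
Proof.
have asyncE P : (0 < P)%N ->
    expected_async_runtime (@X P) = ((P%:R * mu)^-1)%:E.
  move=> P0; apply/cvg_lim => //.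
  exact: mean_async_runtime_cvg hmu (hX P) P0.
have syncE P : (0 < P)%N -> exists2 s,
    expected_sync_runtime (@X P) j = s%:E &
    ln P%:R / (2 * mu) <= s <= 2 / mu * (ln P%:R + 2).
  move=> P0.
  have := expected_sync_runtime_le hmu (hX P) P0 j.
  have := expected_sync_runtime_ge hmu (hX P) P0 j.
  case: (expected_sync_runtime _ _) => [s| |]//; rewrite !lee_fin => s1 s2.
  by exists s => //; rewrite s1.
split=> [P P0|].
  have [s -> _] := syncE P P0; rewrite asyncE//; split=> //.
    by apply: cvgP (mean_async_runtime_cvg hmu (hX P) P0).
  by rewrite eqe invr_eq0 mulf_neq0 ?gt_eqF// ltr0n.
(* The ratio is [s * P * mu], where [s * mu] lies between [ln P / 2] and [2 * (ln P + 2)]; the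
   latter is at most [6 * ln P] once [ln P >= 1], that is, for [P >= expR 1]. *)
rewrite eqThetaE qualifE; apply/asboolP; exists (2^-1, 6) => /=.
  by rewrite invr_gt0 !ltr0n.
near=> P.
have P0 : (0 < P)%N by near: P; exists 1.
have P0R : 0 < P%:R :> R by rewrite ltr0n.
have lnP : 1 <= ln P%:R :> R.
  rewrite -[leLHS]expRK ler_ln ?posrE ?expR_gt0//.
  by near: P; exact: nbhs_infty_ger.
have [s -> /andP[s1 s2]] := syncE P P0.
rewrite asyncE// inver invr_eq0 mulf_eq0 !gt_eqF//= invrK.
have s0 : 0 <= s.
  rewrite (le_trans _ s1)// divr_ge0 ?mulr_ge0// ?ltW//.
  exact: lt_le_trans lnP.
rewrite !ger0_norm ?mulr_ge0 ?(ltW P0R) ?(ltW hmu) ?(le_trans _ lnP)//.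
have smu1 : ln P%:R / 2 <= s * mu.
  by move: s1; rewrite ler_pdivrMr ?mulr_gt0//; lra.
have smu2 : s * mu <= 6 * ln P%:R.
  have : s * mu <= 2 * (ln P%:R + 2).
    by move: s2; rewrite mulrAC ler_pdivlMr.
  lra.
by split; rewrite mulrCA [leRHS]mulrCA ler_pM2l//; lra.
Unshelve. all: by end_near. Qed.
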